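(* Let $n>1$, $p$ an odd prime with $p\nmid n$, $q=p^a$, $t\in\mathbb{F}_q^*$. For any $(c,d)\in\mathbb{Z}^2$ and $0\le i\le 2n$, if $\omega(c,d)\le\frac{g(i)}n$ and $(c,d)\neq\varepsilon_{g(i)}$, then $\mathrm{ord}_pA((c,d),\varepsilon_i)>\omega(c,d)$.
   Context: $\mathrm{ord}_p(p)=1$. Let $\gamma\in\mathbb{C}_p$ be a root of $\sum_{k\ge0}x^{p^k}/p^k$ with $\mathrm{ord}_p\gamma=\frac1{p-1}$, fix $\widetilde\gamma$ with $\widetilde\gamma^n=\gamma$, and $\Theta(x)=\exp(\sum_{k\ge0}(\gamma x)^{p^k}/p^k)$. Let $\bar t\in\mathbb{Z}_q$ be the Teichmüller lift of $t$ and define $B(a,b)$ by $\Theta(x^n)\Theta(y)\Theta(\bar t/(xy))=\sum B(a,b)x^ay^b$. $\sigma$ is the Frobenius of $\mathbb{Q}_q/\mathbb{Q}_p$ extended fixing $\zeta_p,\widetilde\gamma$. Weight $\omega(a,b)=\frac an+b+\frac{2n+1}n\max\{0,-a,-b\}$. $A((c,d),(a,b))=\sigma^{-1}(B(pc-a,pd-b))\widetilde\gamma^{n\omega(a,b)-n\omega(c,d)}$ (the matrix coefficient of Dwork's Frobenius $\sigma^{-1}\circ\psi_p\circ F_t$ with respect to the elements $\widetilde\gamma^{n\omega(a,b)}x^ay^b$). Monomials/lattice points: $\varepsilon_i=x^i$, i.e. $(i,0)$, for $0\le i\le n$, and $\varepsilon_i=x^{i-n}y$, i.e. $(i-n,1)$,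 for $n+1\le i\le 2n$. Let $0<\varpi<n$ be the integer with $p\varpi\equiv1\pmod n$, and define $g$ on $\{0,\dots,2n\}$ by $g(i)=i$ for $i\in\{0,n,2n\}$, $g(i)=\varpi i+n\lceil\frac{-\varpi i}{n}\rceil$ for $1\le i\le n-1$, and $g(i)=n+\varpi i+n\lceil\frac{-\varpi i}{n}\rceil$ for $n+1\le i\le 2n-1$. *)

(* Defs.v *)
From mathcomp Require Import all_boot all_order all_algebra.
From mathcomp Require Import boolp classical_sets constructive_ereal.

Set Implicit Arguments.
Unset Strict Implicit.
Unset Printing Implicit Defensive.

Import Order.TTheory GRing.Theory Num.Theory.
Local Open Scope ring_scope.

(** * Formal power series, as sequences of coefficients *)

Section FormalPowerSeries.
Variable K : fieldType.

Definition fps_one : nat -> K := fun m => (m == 0%N)%:R.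

Definition fps_mul (f g : nat -> K) : nat -> K :=
  fun m => \sum_(i < m.+1) f i * g (m - i)%N.

Definition fps_pow (f : nat -> K) (j : nat) : nat -> K :=
  iter j (fps_mul f) fps_one.

(* The formal exponential of a series f such that f 0 = 0: then f ^ j only
   has monomials of degree >= j, so that the coefficient of x ^ m in
   \sum_j f ^ j / j! is the finite sum below. *)
Definition fps_exp (f : nat -> K) : nat -> K :=
  fun m => \sum_(j < m.+1) fps_pow f j m / (j`!)%:R.

End FormalPowerSeries.

(** * The field C_p *)

Section Valued.
Variables (K : fieldType) (ord : K -> \bar rat).

Definition cvg_ord (u : nat -> K) (l : K) : Prop :=
  forall M : rat, exists N, forall m, (N <= m)%N -> (M%:E <= ord (u m - l))%E.

Definition cauchy_ord (u : nat -> K) : Prop :=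
  forall M : rat, exists N, forall m k, (N <= m)%N -> (N <= k)%N ->
    (M%:E <= ord (u m - u k))%E.

(* The limit of u, and 0 if u does not converge. *)
Definition lim_ord (u : nat -> K) : K := xget 0 [set l | cvg_ord u l].

(* The closure of the prime field: when ord is an extension of the p-adic
   valuation to a complete field, this is Q_p. *)
Definition closure_rat : set K :=
  [set x | forall M : rat, exists r : rat, (M%:E <= ord (x - ratr r))%E].

Definition algebraic_over (k : set K) (x : K) : Prop :=
  exists2 P : {poly K}, P != 0 & (forall i, P`_i \in k) /\ root P x.

End Valued.

(* C_p is the completion of an algebraic closure of Q_p. The fields below
   characterize it up to an isomorphism respecting ord. The value group of
   C_p is the group of rational numbers, whence the codomain of ord. *)
Record padicC (p : nat) := PadicC {
  Cp_field :> closedFieldType ;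
  ordp : Cp_field -> \bar rat ;
  ordp_eq_pinfty : forall x, ordp x = +oo%E <-> x = 0 ;
  ordpM : forall x y, ordp (x * y) = (ordp x + ordp y)%E ;
  ordpD : forall x y, (Order.min (ordp x) (ordp y) <= ordp (x + y))%E ;
  ordp_p : ordp p%:R = 1%E ;
  Cp_complete : forall u, cauchy_ord ordp u -> exists l, cvg_ord ordp u l ;
  Cp_dense : forall (x : Cp_field) (M : rat),
    exists2 y, algebraic_over (closure_rat ordp) y & (M%:E <= ordp (x - y))%E
}.

Arguments ordp {p C} x : rename.

Section PadicFields.
Variables (p : nat) (C : padicC p).

Definition Qp : set C := closure_rat (@ordp p C).

Definition is_subfield (k : set C) : Prop := GRing.divring_closed [in k].

Definition subfield_gen (S : set C) : set C := smallest is_subfield S.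

(* For q = p ^ a, the unramified extension of Q_p of degree a. *)
Definition Qq (q : nat) : set C :=
  subfield_gen (Qp `|` [set z | z ^+ q.-1 = 1])%classic.

Definition Zq (q : nat) : set C := [set x | Qq q x /\ (0 <= ordp x)%E]%classic.

(* red identifies the residue field of Z_q with F; its values outside Z_q are
   irrelevant. *)
Record is_reduction (q : nat) (F : fieldType) (red : C -> F) : Prop := {
  red1 : red 1 = 1 ;
  redD : {in Zq q &, {morph red : x y / x + y}} ;
  redM : {in Zq q &, {morph red : x y / x * y}} ;
  red_eq0 : {in Zq q, forall x, red x = 0 <-> (0 < ordp x)%E} ;
  red_surj : forall u : F, exists2 x, x \in Zq q & red x = u
}.

Definition is_teichmuller (q : nat) (F : fieldType) (red : C -> F)
    (t : F) (tbar : C) : Prop :=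
  [/\ tbar \in Zq q, red tbar = t & tbar ^+ q = tbar].

(* The field Q_q(zeta, gammat). *)
Definition Qq_ext (q : nat) (zeta gammat : C) : set C :=
  subfield_gen (Qq q `|` [set zeta; gammat])%classic.

(* sigma is the automorphism of L = Q_q(zeta, gammat) over Q_p which induces
   the Frobenius on Q_q and fixes zeta and gammat, and sigmaV is its inverse;
   the values of sigma and sigmaV outside L are irrelevant. *)
Record is_frobenius (q : nat) (zeta gammat : C) (sigma sigmaV : C -> C) : Prop
  := {
  frob_stable : {in Qq_ext q zeta gammat,
    forall x, sigma x \in Qq_ext q zeta gammat} ;
  frobV_stable : {in Qq_ext q zeta gammat,
    forall x, sigmaV x \in Qq_ext q zeta gammat} ;
  frobK : {in Qq_ext q zeta gammat, cancel sigma sigmaV} ;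
  frobVK : {in Qq_ext q zeta gammat, cancel sigmaV sigma} ;
  frobD : {in Qq_ext q zeta gammat &, {morph sigma : x y / x + y}} ;
  frobM : {in Qq_ext q zeta gammat &, {morph sigma : x y / x * y}} ;
  frob_Qp : {in Qp, forall x, sigma x = x} ;
  frob_Zq : {in Zq q,
    forall x, sigma x \in Zq q /\ (0 < ordp (sigma x - x ^+ p))%E} ;
  frob_zeta : sigma zeta = zeta ;
  frob_gammat : sigma gammat = gammat
}.

End PadicFields.

(** * The Dwork splitting function and the Frobenius matrix *)

Section Dwork.
Variables (p : nat) (C : padicC p).

Definition AH_root (gamma : C) : Prop :=
  cvg_ord (@ordp p C)
    (fun N => \sum_(k < N) gamma ^+ (p ^ k) / (p ^ k)%:R) 0.

(* Coefficients of \sum_k (gamma x) ^ (p ^ k) / p ^ k (recall k < p ^ k). *)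
Definition AH_log (gamma : C) : nat -> C := fun m =>
  \sum_(k < m.+1 | (p ^ k == m)%N) gamma ^+ (p ^ k) / (p ^ k)%:R.

Definition Theta (gamma : C) : nat -> C := fps_exp (AH_log gamma).

(* The coefficient of x ^ a y ^ b in Theta(x ^ n) Theta(y) Theta(tbar / (xy)),
   where all three series are truncated at degree < N. *)
Definition Bpartial (n : nat) (gamma tbar : C) (a b : int) (N : nat) : C :=
  \sum_(i < N) \sum_(j < N)
    \sum_(k < N | ((n * i)%N%:Z - k%:Z == a) && (j%:Z - k%:Z == b))
      Theta gamma i * Theta gamma j * (Theta gamma k * tbar ^+ k).

Definition B (n : nat) (gamma tbar : C) (a b : int) : C :=
  lim_ord (@ordp p C) (Bpartial n gamma tbar a b).

End Dwork.

Definition omega (n : nat) (u : int * int) : rat :=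
  u.1%:~R / n%:R + u.2%:~R
  + (2 * n + 1)%:R / n%:R * (Num.max 0 (Num.max (- u.1) (- u.2)))%:~R.

(* n * omega n u as an integer, see nomegaE. *)
Definition nomega (n : nat) (u : int * int) : int :=
  u.1 + n%:Z * u.2 + (2 * n + 1)%:Z * Num.max 0 (Num.max (- u.1) (- u.2)).

Lemma nomegaE n u : (0 < n)%N -> (nomega n u)%:~R = n%:R * omega n u.
Proof.
move=> n_gt0; have n0 : n%:R != 0 :> rat by rewrite pnatr_eq0 -lt0n.
rewrite /nomega /omega !mulrDr mulrCA divff // mulr1.
by rewrite mulrA (mulrCA n%:R) divff // mulr1 !intrD !intrM -!pmulrn.
Qed.

Definition A (p n : nat) (C : padicC p) (sigmaV : C -> C)
    (gamma gammat tbar : C) (u v : int * int) : C :=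
  sigmaV (B n gamma tbar (p%:Z * u.1 - v.1) (p%:Z * u.2 - v.2))
  * gammat ^ (nomega n v - nomega n u).

(* The lattice points epsilon_i, for 0 <= i <= 2n. *)
Definition eps (n : nat) (i : int) : int * int :=
  if i <= n%:Z then (i, 0) else (i - n%:Z, 1).

Definition ceil_term (n varpi i : nat) : int :=
  (varpi * i)%:Z + n%:Z * Num.ceil (- (varpi * i)%:R / n%:R : rat).

(* Meant for 0 <= i <= 2n. *)
Definition g (n varpi i : nat) : int :=
  if i \in [:: 0; n; 2 * n]%N then i%:Z
  else if (i < n)%N then ceil_term n varpi i
  else n%:Z + ceil_term n varpi i.

(* Main.v *)
From HB Require Import structures.
Require Import Defs.
From mathcomp Require Import all_boot all_order all_algebra.
From mathcomp Require Import boolp classical_sets constructive_ereal.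
From mathcomp Require Import ring lra zify.

(** The Artin-Hasse exponential has p-integral coefficients e_m (Dwork's lemma:
    f(x)^p = f(x^p) exp(p x)), so the coefficient of x^m in Theta is
    e_m gamma^m, of order at least m / (p - 1). As u = gamma^(p - 1) is the
    fixed point in p Z_p of a contraction with rational coefficients, it lies in
    Q_p. Grouping the terms of B(a, b) by the exponent of tbar modulo q - 1 and
    of gamma modulo p - 1 writes B(a, b) as a finite sum of
    tbar^r gamma^s l_(r,s) with l_(r,s) in Q_p. Since sigma^-1 fixes gamma and
    Q_p and maps the root of unity tbar to a root of unity, sigma^-1(B(a, b))
    has order at least min (i + j + k) / (p - 1), over the terms
    (x^n)^i y^j (tbar/(xy))^k that contribute to x^a y^b. For
    (a, b) = p (c, d) - eps_i these satisfy
    n (i + j + k) + i >= p n omega(c, d), and equality would force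
    (c, d) = eps_(g(i)) because of the congruence c = varpi i modulo n. *)

Set Implicit Arguments.
Unset Strict Implicit.
Unset Printing Implicit Defensive.

Import Order.TTheory GRing.Theory Num.Theory.
Local Open Scope ring_scope.

(** * Exponentials of polynomials modulo powers of X *)

Lemma dvdXnP (K : fieldType) m (P : {poly K}) :
  reflect (forall i, (i < m)%N -> P`_i = 0) ('X^m %| P).
Proof.
apply: (iffP idP) => [/dvdpP[Q ->] i im|P0]; first by rewrite coefMXn im.
rewrite -(poly_take_drop m P) (_ : take_poly m P = 0) ?add0r ?dvdp_mulIr //.
by apply/polyP => i; rewrite coef_take_poly coef0; case: ifP => // /P0.
Qed.

Section FormalExponential.
Variable K : fieldType.
Hypothesis K_char0 : forall m, (0 < m)%N -> m%:R != 0 :> K.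
Implicit Types (f : nat -> K) (P D : {poly K}).

Definition exp_trunc N P : {poly K} := \sum_(j < N) (j`!%:R)^-1 *: P ^+ j.

Lemma fps_pow_poly N f P j m : (forall i, (i < N)%N -> P`_i = f i) ->
  (m < N)%N -> fps_pow f j m = (P ^+ j)`_m.
Proof.
move=> Pf; elim: j m => [|j IH] m mN; first by rewrite expr0 coef1.
have -> : fps_pow f j.+1 m = \sum_(i < m.+1) f i * fps_pow f j (m - i)%N by [].
rewrite exprS coefM; apply: eq_bigr => i _; have im := ltn_ord i.
by rewrite Pf ?IH //; lia.
Qed.

Lemma dvdXn_expr P j : P`_0 = 0 -> ('X^j %| P ^+ j).
Proof.
move=> P0; apply: dvdp_exp2r; rewrite -['X]expr1; apply/dvdXnP.
by case.
Qed.

(** As ['X^j] divides [P ^+ j], terms of index above [m] do not reach degree [m], so the longer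
    truncation is harmless. *)
Lemma fps_exp_poly N f P m : f 0%N = 0 -> (forall i, (i < N)%N -> P`_i = f i) ->
  (m < N)%N -> fps_exp f m = (exp_trunc N P)`_m.
Proof.
move=> f0 Pf mN; rewrite coef_sum /fps_exp (big_ord_widen N
  (fun j => fps_pow f j m / (j`!)%:R)) // big_mkcond.
apply: eq_bigr => j _; rewrite coefZ (fps_pow_poly _ Pf) // mulrC.
case: ifP => // /negbT; rewrite -leqNgt => mj.
have P0 : P`_0 = 0 by rewrite Pf ?f0 //; lia.
by rewrite (dvdXnP _ _ (dvdXn_expr j P0)) ?mulr0.
Qed.

Lemma deriv_exp_trunc N P : (exp_trunc N.+1 P)^`() = P^`() * exp_trunc N P.
Proof.
rewrite /exp_trunc raddf_sum big_ord_recl /= derivZ expr0 derivC scaler0 add0r.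
rewrite mulr_sumr; apply: eq_bigr => j _.
rewrite derivZ deriv_exp /bump /= add1n -scalerAr mulrC -mulrnAr.
rewrite -scaler_nat -scalerAr scalerA factS natrM invfM mulrAC mulVf ?mul1r //.
exact: K_char0.
Qed.

(** Differentiation drops the last term, a multiple of [P ^+ N], which ['X^N] divides. *)
Lemma exp_trunc_ode N P : P`_0 = 0 ->
  ('X^N %| (exp_trunc N.+1 P)^`() - P^`() * exp_trunc N.+1 P)%R.
Proof.
move=> P0; rewrite deriv_exp_trunc /exp_trunc big_ord_recr /= -mulrBr.
rewrite opprD addrA subrr add0r.
by rewrite dvdp_mull // dvdpNr -mul_polyC dvdp_mull // dvdXn_expr.
Qed.

(** In degree [i] the equation expresses [i.+1] times the next coefficient through lower ones, which
    vanish by induction. *)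
Lemma ode_unique N D P : P`_0 = 0 -> ('X^N %| P^`() - D * P)%R ->
  ('X^(N.+1) %| P).
Proof.
move=> P0 /dvdXnP ode; apply/dvdXnP; elim/ltn_ind => -[//|i] IH iN.
have := ode i iN; rewrite coefB coef_deriv coefM big1 => [|j _].
  rewrite subr0 -mulr_natr => /eqP; rewrite mulf_eq0 (negPf (K_char0 _)) //.
  by rewrite orbF => /eqP.
by rewrite IH ?mulr0 //; have := ltn_ord j; lia.
Qed.

End FormalExponential.

(** * Divisibility of binomial coefficients and valuation of factorials *)

Lemma exprD_prime (R : comNzRingType) (S : subringClosed R) p x y : prime p ->
  x \in S -> y \in S ->
  exists2 z, z \in S & (x + y) ^+ p = x ^+ p + y ^+ p + p%:R * z.
Proof.
case: p => // q pp Sx Sy.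
exists (\sum_(i < q)
  (x ^+ (q.+1 - i.+1) * y ^+ i.+1 *+ ('C(q.+1, i.+1) %/ q.+1))).
  by apply: rpred_sum => i _; rewrite rpredMn // rpredM // rpredX.
rewrite exprDn big_ord_recl big_ord_recr /= /bump /= add1n.
rewrite subn0 subnn bin0 binn !mulr1n expr0 expr0 mulr1 mul1r.
rewrite addrA addrAC; congr (_ + _); rewrite mulr_sumr.
apply: eq_bigr => i _; rewrite add1n mulr_natl -mulrnA divnK //.
by apply: prime_dvd_bin => //; have := ltn_ord i; lia.
Qed.

Lemma logn_fact_lt p m : prime p -> (0 < m)%N -> (logn p m`! < m)%N.
Proof.
move=> pp m0; rewrite logn_fact //; have p2 := prime_gt1 pp.
set K := trunc_log p m.
have /andP[lo hi] : (p ^ K <= m < p ^ K.+1)%N by apply: trunc_log_bounds.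
have Km : (K <= m)%N by apply: leq_trans (ltnW (ltn_expl K p2)) lo.
(* In Legendre's formula each term is at most half the previous one. At [k = K] the extra term
   [m %/ p ^ K] is still positive, whence the strict inequality. *)
have telescope k : (\sum_(1 <= i < k.+1) m %/ p ^ i + m %/ p ^ k <= m)%N.
  elim: k => [|k IH]; first by rewrite big_geq // expn0 divn1.
  rewrite big_nat_recr //=; apply: leq_trans IH.
  rewrite -addnA leq_add2l expnSr divnMA.
  have := leq_trunc_div (m %/ p ^ k) p; rewrite addnn -muln2.
  by apply: leq_trans; rewrite leq_mul2l p2 orbT.
have tail0 : (\sum_(K.+1 <= i < m.+1) m %/ p ^ i = 0)%N.
  rewrite big_nat big1 // => i /andP[Ki _]; apply: divn_small.
  by apply: leq_trans hi _; rewrite leq_exp2l.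
rewrite (@big_cat_nat _ _ _ K.+1) //= tail0 addn0.
apply: leq_trans (telescope K).
by rewrite -[X in (X < _)%N]addn0 ltn_add2l divn_gt0 // expn_gt0; lia.
Qed.

(** * The valuation of C_p *)

Section Valuation.
Variables (p : nat) (C : padicC p).
Implicit Types (x y : C) (M : rat).

Definition ord_ge M x := (M%:E <= ordp x)%E.

Lemma ordp0 : ordp (0 : C) = +oo%E.
Proof. exact/ordp_eq_pinfty. Qed.

Lemma ordp_fin x : x != 0 -> exists v, ordp x = v%:E.
Proof.
move=> x0; case E: (ordp x) => [v||]; first by exists v.
  by move/ordp_eq_pinfty: E x0 => ->; rewrite eqxx.
(* Order -oo is impossible: -oo + +oo is -oo by convention, while [x * 0] has order +oo. *)
by have := ordpM x 0; rewrite mulr0 ordp0 E.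
Qed.

Lemma ordp1 : ordp (1 : C) = 0%E.
Proof.
have [v E] := ordp_fin (oner_neq0 C).
have := ordpM (1 : C) 1; rewrite mulr1 E => -[] ?.
by congr (_%:E); lra.
Qed.

Lemma ordpN x : ordp (- x) = ordp x.
Proof.
have N10 : (-1 : C) != 0 by rewrite oppr_eq0 oner_neq0.
have [v E] := ordp_fin N10.
have := ordpM (-1 : C) (-1); rewrite mulrNN mulr1 ordp1 E => -[] ?.
by rewrite -mulN1r ordpM E (_ : v = 0) ?add0e //; lra.
Qed.

Lemma ordpX x v m : ordp x = v%:E -> ordp (x ^+ m) = (m%:R * v)%:E.
Proof.
move=> xv; elim: m => [|m IH]; first by rewrite expr0 ordp1 mul0r.
by rewrite exprS ordpM xv IH -EFinD; congr (_%:E); rewrite -natr1; ring.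
Qed.

Lemma ordpV x v : ordp x = v%:E -> ordp x^-1 = (- v)%:E.
Proof.
move=> xv; have x0 : x != 0 by apply/eqP=> x0; move: xv; rewrite x0 ordp0.
have [w E] := ordp_fin (invr_neq0 x0).
have := ordpM x x^-1; rewrite divff // ordp1 xv E => -[] ?.
by congr (_%:E); lra.
Qed.

Lemma ordp_exprz x v (m : int) : ordp x = v%:E -> ordp (x ^ m) = (m%:~R * v)%:E.
Proof.
move=> xv; case: m => m; first by rewrite -exprnP (ordpX m xv).
rewrite NegzE -exprnN (ordpV (ordpX m.+1 xv)).
by congr (_%:E); rewrite mulrNz mulNr.
Qed.

Lemma ord_ge_le M N x : N <= M -> ord_ge M x -> ord_ge N x.
Proof. by move=> NM; apply: le_trans; rewrite lee_fin. Qed.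

Lemma ord_ge0 M : ord_ge M 0.
Proof. by rewrite /ord_ge ordp0 leey. Qed.

Lemma ord_geN M x : ord_ge M (- x) = ord_ge M x.
Proof. by rewrite /ord_ge ordpN. Qed.

Lemma ord_geD M x y : ord_ge M x -> ord_ge M y -> ord_ge M (x + y).
Proof.
by move=> Mx My; apply: le_trans (ordpD x y); rewrite le_min; apply/andP.
Qed.

Lemma ord_geB M x y : ord_ge M x -> ord_ge M y -> ord_ge M (x - y).
Proof. by move=> Mx My; apply: ord_geD; rewrite ?ord_geN. Qed.

Lemma ord_geM M N x y : ord_ge M x -> ord_ge N y -> ord_ge (M + N) (x * y).
Proof. by move=> Mx Ny; rewrite /ord_ge ordpM EFinD leeD. Qed.

Lemma ord_ge1 : ord_ge 0 (1 : C).
Proof. by rewrite /ord_ge ordp1. Qed.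

Lemma ord_geX M x m : ord_ge M x -> ord_ge (m%:R * M) (x ^+ m).
Proof.
move=> Mx; elim: m => [|m IH]; first by rewrite mul0r expr0 ord_ge1.
by rewrite exprS -natr1 mulrDl mul1r addrC; apply: ord_geM.
Qed.

Lemma ord_ge_sum M (I : Type) (r : seq I) (P : pred I) (f : I -> C) :
  (forall i, P i -> ord_ge M (f i)) -> ord_ge M (\sum_(i <- r | P i) f i).
Proof.
move=> fP; apply: (big_ind (ord_ge M)) => //; first exact: ord_ge0.
by move=> *; exact: ord_geD.
Qed.

Lemma ord_ge_nat m : ord_ge 0 (m%:R : C).
Proof.
elim: m => [|m IH]; first exact: ord_ge0.
by rewrite -natr1; apply: ord_geD => //; exact: ord_ge1.
Qed.

Lemma ord_ge_int (m : int) : ord_ge 0 (m%:~R : C).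
Proof.
by case: m => m; rewrite ?NegzE ?mulrNz ?ord_geN -pmulrn; exact: ord_ge_nat.
Qed.

Lemma ord_ge_infty x : (forall M, ord_ge M x) -> x = 0.
Proof.
move=> Mx; apply: contrapT => /eqP/ordp_fin[v E].
by have := Mx (v + 1); rewrite /ord_ge E lee_fin gerDl ler10.
Qed.

(** * Integers and p-local rational numbers in C_p *)

Hypothesis p_prime : prime p.

(** By Bezout, 1 is [u * d - v * p]; if [d] had positive order, so would 1. *)
Lemma ordp_coprime (d : nat) : coprime p d -> ordp (d%:R : C) = 0%E.
Proof.
move=> pd; apply/eqP; rewrite eq_le; apply/andP; split;
  last exact: (ord_ge_nat d).
have d_gt0 : (0 < d)%N.
  case: d pd => //; rewrite /coprime gcdn0 => /eqP p1.
  by have := p_prime; rewrite p1.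
have [u v E _] := egcdnP p d_gt0.
move: E; rewrite gcdnC (eqP pd) => E.
have {}E : 1 = u%:R * d%:R - v%:R * p%:R :> C.
  by rewrite -!natrM E natrD addrAC subrr add0r.
rewrite leNgt; apply/negP => d_pos.
have : (0 < ordp (u%:R * d%:R - v%:R * p%:R : C))%E.
  apply: lt_le_trans (ordpD _ _); rewrite lt_min; apply/andP; split.
    rewrite ordpM; apply: lt_le_trans d_pos (leeDr _ _).
    exact: (ord_ge_nat u).
  rewrite ordpN ordpM ordp_p; apply: (@lt_le_trans _ _ 1%E) => //.
  by apply: leeDr; exact: (ord_ge_nat v).
by rewrite -E ordp1 ltxx.
Qed.

Lemma natr_neq0 (m : nat) : (0 < m)%N -> m%:R != 0 :> C.
Proof.
move=> m_gt0; have [d pd ->] := pfactor_coprime p_prime m_gt0.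
rewrite natrM natrX.
apply: mulf_neq0; [|apply: expf_neq0]; apply/eqP => E0.
  by have := ordp_coprime pd; rewrite E0 ordp0.
by have := ordp_p C; rewrite E0 ordp0.
Qed.

Lemma intr_eq0C (m : int) : (m%:~R == 0 :> C) = (m == 0).
Proof.
apply/idP/idP => [|/eqP -> //]; case: m => m.
  by case: m => // m; rewrite -pmulrn (negPf (natr_neq0 (ltn0Sn _))).
by rewrite NegzE mulrNz oppr_eq0 -pmulrn (negPf (natr_neq0 (ltn0Sn _))).
Qed.

(** The image in [C] of the localization of the integers at [p]. *)
Definition p_local : {pred C} := fun x => `[< exists (m : int) (d : nat),
  coprime p d /\ x = m%:~R / d%:R >].

Lemma coprime_neq0 (d : nat) : coprime p d -> d%:R != 0 :> C.
Proof.
by move=> /ordp_coprime E; apply/eqP => d0; move: E; rewrite d0 ordp0.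
Qed.

Fact p_local_subring : subring_closed p_local.
Proof.
split.
- apply/asboolP; exists 1, 1%N; rewrite coprimen1; split=> //.
  by rewrite divr1.
- move=> x y /asboolP[m [d [pd ->]]] /asboolP[n [e [pe ->]]].
  apply/asboolP; exists (m * e%:Z - n * d%:Z), (d * e)%N.
  rewrite coprimeMr pd pe; split=> //.
  rewrite natrM intrB !intrM -!pmulrn; field.
  by rewrite !coprime_neq0.
- move=> x y /asboolP[m [d [pd ->]]] /asboolP[n [e [pe ->]]].
  apply/asboolP; exists (m * n), (d * e)%N.
  rewrite coprimeMr pd pe; split=> //.
  by rewrite intrM natrM invfM mulrACA.
Qed.
HB.instance Definition _ :=
  GRing.isSubringClosed.Build C p_local p_local_subring.

Lemma p_local_ord x : x \in p_local -> ord_ge 0 x.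
Proof.
move=> /asboolP[m [d [pd ->]]]; rewrite -[0]addr0; apply: ord_geM.
  exact: ord_ge_int.
by rewrite /ord_ge (ordpV (ordp_coprime pd)) oppr0.
Qed.

Lemma ratr_frac (m : int) (d : nat) : (0 < d)%N ->
  ratr (m%:Q / d%:R) = m%:~R / d%:R :> C.
Proof.
move=> d_gt0; rewrite /ratr.
move: (denq_neq0 (m%:Q / d%:R)) (divq_num_den (m%:Q / d%:R)).
move: (numq _) (denq _) => a b b0 /eqP; rewrite [d%:R]pmulrn.
have d0 : d%:Z != 0 by rewrite -lt0n in d_gt0 *.
rewrite eqr_div ?intr_eq0 // -!intrM eqr_int => /eqP E; apply/eqP.
by rewrite [d%:R]pmulrn eqr_div ?intr_eq0C // -!intrM E.
Qed.

(** * Rational elements, Q_p and limits *)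

Definition is_ratr x := exists r : rat, x = ratr r.

Lemma is_ratrP x :
  is_ratr x <-> exists (m : int) (d : nat), (0 < d)%N /\ x = m%:~R / d%:R.
Proof.
split=> [[r ->]|[m [d [d_gt0 ->]]]]; last first.
  by exists (m%:Q / d%:R); rewrite ratr_frac.
exists (numq r), `|denq r|%N; rewrite absz_gt0 denq_neq0; split=> //.
by rewrite /ratr pmulrn absz_denq.
Qed.

Lemma is_ratr_local x : x \in p_local -> is_ratr x.
Proof.
move=> /asboolP[m [d [pd xE]]]; apply/is_ratrP; exists m, d; split=> //.
by rewrite lt0n; apply/eqP => d0; move: (coprime_neq0 pd); rewrite d0 eqxx.
Qed.

Lemma is_ratrD x y : is_ratr x -> is_ratr y -> is_ratr (x + y).
Proof.
move=> /is_ratrP[m [d [d0 ->]]] /is_ratrP[n [e [e0 ->]]].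
apply/is_ratrP; exists (m * e%:Z + n * d%:Z), (d * e)%N.
rewrite muln_gt0 d0 e0; split=> //.
rewrite natrM intrD !intrM -!pmulrn; field.
by rewrite !natr_neq0.
Qed.

Lemma is_ratrM x y : is_ratr x -> is_ratr y -> is_ratr (x * y).
Proof.
move=> /is_ratrP[m [d [d0 ->]]] /is_ratrP[n [e [e0 ->]]].
apply/is_ratrP; exists (m * n), (d * e)%N.
by rewrite muln_gt0 d0 e0 intrM natrM invfM mulrACA.
Qed.

Lemma is_ratrX x m : is_ratr x -> is_ratr (x ^+ m).
Proof.
move=> xr; elim: m => [|m IH]; last by rewrite exprS; apply: is_ratrM.
by apply: is_ratr_local; exact: rpred1.
Qed.

Lemma is_ratr_natV (d : nat) : (0 < d)%N -> is_ratr (d%:R^-1).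
Proof. by move=> d0; apply/is_ratrP; exists 1, d; rewrite mul1r. Qed.

Lemma Qp_ratr x : is_ratr x -> Qp x.
Proof. by move=> [r ->] M; exists r; rewrite subrr ordp0 leey. Qed.

Lemma QpP x : Qp x <-> forall M, exists2 y, is_ratr y & ord_ge M (x - y).
Proof.
split=> [Qx M|Qx M]; first by have [r] := Qx M; exists (ratr r) => //; exists r.
by have [_ [r ->]] := Qx M; exists r.
Qed.

Lemma QpD x y : Qp x -> Qp y -> Qp (x + y).
Proof.
move=> /QpP Qx /QpP Qy; apply/QpP => M.
have [[r rr xr] [s rs ys]] := (Qx M, Qy M).
by exists (r + s); [exact: is_ratrD | rewrite opprD addrACA; exact: ord_geD].
Qed.

Lemma ord_ge_exists x : exists M, ord_ge M x.
Proof.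
have [->|/ordp_fin[v E]] := eqVneq x 0; first by exists 0; exact: ord_ge0.
by exists v; rewrite /ord_ge E.
Qed.

Lemma QpM x y : Qp x -> Qp y -> Qp (x * y).
Proof.
move=> /QpP Qx /QpP Qy; apply/QpP => M.
have [N Ny] := ord_ge_exists y; have [r rr xr] := Qx (M - N).
have [L Lr] := ord_ge_exists r; have [s rs ys] := Qy (M - L).
exists (r * s); first exact: is_ratrM.
rewrite (_ : _ - _ = (x - r) * y + r * (y - s)); last by ring.
apply: ord_geD; first by rewrite -[M](subrK N); apply: ord_geM.
by rewrite -[M](subrK L) addrC; apply: ord_geM.
Qed.

Lemma Qp1 : Qp (1 : C).
Proof. by apply: Qp_ratr; apply: is_ratr_local; exact: rpred1. Qed.

Lemma QpX x m : Qp x -> Qp (x ^+ m).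
Proof.
move=> Qx; elim: m => [|m IH]; last by rewrite exprS; apply: QpM.
exact: Qp1.
Qed.

Lemma Qp0 : Qp (0 : C).
Proof. by apply: Qp_ratr; apply: is_ratr_local; exact: rpred0. Qed.

Lemma Qp_cvg (u : nat -> C) l :
  (forall m, Qp (u m)) -> cvg_ord (@ordp p C) u l -> Qp l.
Proof.
move=> Qu ul; apply/QpP => M; have [N /(_ N (leqnn N)) uNl] := ul M.
have /QpP/(_ M)[r rr ur] := Qu N; exists r => //.
rewrite (_ : _ - r = (u N - r) - (u N - l)); last by ring.
exact: ord_geB.
Qed.

Lemma ord_ge_cvg M (u : nat -> C) l :
  (forall m, ord_ge M (u m)) -> cvg_ord (@ordp p C) u l -> ord_ge M l.
Proof.
move=> Mu ul; have [N /(_ N (leqnn N)) uNl] := ul M.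
rewrite (_ : l = u N - (u N - l)); last by ring.
exact: ord_geB.
Qed.

Lemma cvg_ordD (u v : nat -> C) l m : cvg_ord (@ordp p C) u l ->
  cvg_ord (@ordp p C) v m -> cvg_ord (@ordp p C) (fun i => u i + v i) (l + m).
Proof.
move=> ul vm M; have [N HN] := ul M; have [N' HN'] := vm M.
exists (maxn N N') => i; rewrite geq_max => /andP[Ni N'i].
by rewrite opprD addrACA; apply: ord_geD; [exact: HN | exact: HN'].
Qed.

Lemma cvg_ordZ c (u : nat -> C) l : cvg_ord (@ordp p C) u l ->
  cvg_ord (@ordp p C) (fun i => c * u i) (c * l).
Proof.
move=> ul M; have [L Lc] := ord_ge_exists c; have [N HN] := ul (M - L).
exists N => i Ni; rewrite -mulrBr -[M](subrK L) addrC; apply: ord_geM => //.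
exact: HN.
Qed.

Lemma cvg_ord_sum (I : Type) (r : seq I) (u : I -> nat -> C) (l : I -> C) :
  (forall i, cvg_ord (@ordp p C) (u i) (l i)) ->
  cvg_ord (@ordp p C) (fun m => \sum_(i <- r) u i m) (\sum_(i <- r) l i).
Proof.
move=> ul; elim: r => [|i r IH].
  by move=> M; exists 0%N => m _; rewrite !big_nil subr0; exact: ord_ge0.
rewrite big_cons (_ : (fun m => _) = fun m => u i m + \sum_(i <- r) u i m).
  by apply: cvg_ordD.
by apply/funext => m; rewrite big_cons.
Qed.

Lemma lim_ordE (u : nat -> C) l :
  cvg_ord (@ordp p C) u l -> lim_ord (@ordp p C) u = l.
Proof.
move=> ul; rewrite /lim_ord; case: xgetP => [m _ um|/(_ l)]; last by case.
apply/eqP; rewrite -subr_eq0; apply/eqP/ord_ge_infty => M.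
have [N HN] := ul M; have [N' HN'] := um M; set K := maxn N N'.
rewrite (_ : m - l = (u K - l) - (u K - m)); last by ring.
by apply: ord_geB; [apply: HN | apply: HN']; rewrite ?leq_maxl ?leq_maxr.
Qed.

Lemma p_local_natV d : coprime p d -> d%:R^-1 \in p_local.
Proof. by move=> pd; apply/asboolP; exists 1, d; rewrite mul1r. Qed.

Lemma natr_p_neq0 : p%:R != 0 :> C.
Proof. exact: natr_neq0 (prime_gt0 p_prime). Qed.

(** * Fermat's congruence and Frobenius on p-local polynomials *)

Hypothesis p_odd : odd p.

Lemma p_local_fermat x :
  x \in p_local -> exists2 z, z \in p_local & x ^+ p = x + p%:R * z.
Proof.
have nat_case (m : nat) : exists k : int, (m%:R : C) ^+ p = m%:R + p%:R * k%:~R.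
  have mp : (m <= m ^ p)%N.
    case: m => // m; rewrite -{1}[m.+1]expn1.
    by apply: leq_pexp2l => //; exact: prime_gt0.
  have /eqP := fermat_little m p_prime.
  rewrite eqn_mod_dvd // => /dvdnP[k E]; exists k%:Z.
  rewrite -natrX -pmulrn -natrM -natrD; congr (_%:R).
  by rewrite mulnC -E subnKC.
have int_case (m : int) :
    exists k : int, (m%:~R : C) ^+ p = m%:~R + p%:R * k%:~R.
  case: m => m; first exact: nat_case.
  have [k E] := nat_case m.+1; exists (- k).
  by rewrite NegzE !mulrNz -!pmulrn exprNn -signr_odd p_odd expr1 E; ring.
move=> /asboolP[m [d [pd ->]]]; have [k mE] := int_case m.
have [l dE] := int_case d; rewrite -!pmulrn in dE.
have dp : coprime p (d ^ p * d) by rewrite coprimeMr coprimeXr.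
(* From $m^p=m+pk$ and $d^p=d+pl$ one gets $m^p/d^p-m/d=p(kd-ml)/(d^pd)$. *)
exists ((k * d%:Z - m * l)%:~R / (d ^ p * d)%:R).
  by rewrite rpredM ?p_local_natV // rpred_int.
rewrite expr_div_n mE natrM natrX intrB !intrM -!pmulrn; rewrite dE.
have := coprime_neq0 pd; have : d%:R ^+ p != 0 :> C.
  by rewrite expf_neq0 // coprime_neq0.
rewrite dE => d0 d0'; field.
by rewrite d0 d0'.
Qed.

(** Modulo [p], the power map is additive and fixes p-local numbers, so $A(x)^p$ is congruent to
    $A(x^p)$; monomials are added one at a time. *)
Lemma p_local_frobenius (f : nat -> C) n :
  (forall i, (i < n)%N -> f i \in p_local) ->
  exists2 B, B \is a polyOver p_local &
    (\poly_(i < n) f i) ^+ p = (\poly_(i < n) f i) \Po 'X^p + p%:R * B.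
Proof.
elim: n => [|n IH] fP.
  exists 0; rewrite ?rpred0 // poly_def big_ord0 comp_poly0 mulr0 addr0.
  by rewrite expr0n eqn0Ngt prime_gt0.
have [|B BP E] := IH; first by move=> i iN; apply: fP; apply: ltnW.
have [z zP fE] := p_local_fermat (fP n (ltnSn n)).
have AP : \poly_(i < n) f i \is a polyOver p_local.
  by apply/polyOver_poly => i iN; apply: fP; apply: ltnW.
have XP : f n *: 'X^n \is a polyOver p_local.
  by rewrite polyOverZ ?polyOverXn // fP.
have [D DP DE] := exprD_prime p_prime AP XP.
exists (B + z *: 'X^(n * p) + D).
  by rewrite !rpredD // polyOverZ ?polyOverXn.
have -> : \poly_(i < n.+1) f i = \poly_(i < n) f i + f n *: 'X^n.
  by rewrite !poly_def big_ord_recr.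
rewrite DE E comp_polyD comp_polyZ comp_Xn_poly -exprM mulnC.
rewrite exprZn -exprM fE scalerDl -scalerA -!mul_polyC polyC_natr.
by rewrite mulnC; ring.
Qed.

(** * Integrality of the Artin-Hasse exponential *)

Lemma AH_logE (gamma : C) m : AH_log gamma m =
  if (m == p ^ logn p m)%N then gamma ^+ m / m%:R else 0.
Proof.
rewrite /AH_log; have p2 := prime_gt1 p_prime.
have [mE|mE] := eqVneq m (p ^ logn p m)%N; last first.
  rewrite big_pred0 // => k; apply: contraNF mE => /eqP <-.
  by rewrite pfactorK.
have km : (logn p m < m.+1)%N by rewrite ltnS {2}mE ltnW // ltn_expl.
rewrite (big_pred1 (Ordinal km)) /= -?mE // => k.
apply/eqP/eqP => [kE|->]; last by rewrite /= -mE.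
by apply: val_inj; move: (congr1 (logn p) kE); rewrite /= pfactorK.
Qed.

(** Coefficients of the Artin-Hasse exponential $\exp(\sum_k x^{p^k}/p^k)$. *)
Let e : nat -> C := Theta 1.
Let logP N : {poly C} := \poly_(i < N) AH_log 1 i.

Lemma AH_log0 (gamma : C) : AH_log gamma 0 = 0.
Proof. by rewrite AH_logE logn0. Qed.

Lemma coef_deriv_log N i : (i < N)%N ->
  (logP N.+1)^`()`_i = (i.+1 == p ^ logn p i.+1)%N%:R.
Proof.
move=> iN; rewrite coef_deriv coef_poly ltnS iN AH_logE expr1n.
case: eqP => _; last by rewrite mul0rn.
by rewrite div1r -[LHS]mulr_natr mulVf ?natr_neq0.
Qed.

(** For $L(x)=\sum_k x^{p^k}/p^k$ the derivative is $\sum_k x^{p^k-1}$, whence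
    $L'(x)=1+x^{p-1}L'(x^p)$. *)
Lemma deriv_log_frobenius N : 'X^N %|
  (logP N.+1)^`() - 1 - ((logP N.+1)^`() \Po 'X^p) * 'X^(p.-1).
Proof.
have p_gt0 := prime_gt0 p_prime.
apply/dvdXnP => i iN; rewrite !coefB coefMXn coef_deriv_log // coef1.
rewrite coef_comp_poly_Xn //; case: ltnP => ip.
  have /eqP-> : logn p i.+1 == 0%N.
    by rewrite lognE p_prime /=; case: ifP => // /dvdn_leq; lia.
  by rewrite subr0 expn0 eqSS subrr.
have iE : (i.+1 = (i - p.-1) + p)%N by lia.
rewrite (_ : (i == 0)%N = false); last by have := prime_gt1 p_prime; lia.
rewrite subr0 -(dvdn_addl _ (dvdnn p)) -iE.
case: ifP => [/dvdnP[l lE]|/negbT pi]; last first.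
  have -> : logn p i.+1 = 0%N by rewrite lognE p_prime (negPf pi).
  rewrite expn0 (_ : (i.+1 == 1)%N = false) ?subrr //.
  by have := prime_gt1 p_prime; lia.
have l0 : (0 < l)%N by rewrite lt0n; apply: contraPneq lE => ->.
have -> : (i - p.-1 = l.-1 * p)%N.
  by case: l l0 lE => // l _; rewrite mulSn /=; lia.
rewrite mulnK // coef_deriv_log; last first.
  by rewrite prednK //; apply: leq_trans iN; rewrite lE leq_pmulr.
rewrite prednK // lE lognM // -[X in (_ + logn p X)%N]expn1 pfactorK // addn1.
by rewrite expnSr eqn_pmul2r // subrr.
Qed.

Lemma AH_coef_ode m : 'X^m %|
  (\poly_(i < m.+1) e i)^`() - (logP m.+1)^`() * \poly_(i < m.+1) e i.
Proof.
set E := \poly_(i < _) _; set Q := exp_trunc m.+1 (logP m.+1).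
have EQ i : (i < m.+1)%N -> E`_i = Q`_i.
  move=> im; rewrite coef_poly im /e /Theta.
  rewrite (fps_exp_poly (P := logP m.+1) (AH_log0 1) _ im) // => j jm.
  by rewrite coef_poly jm.
have L0 : (logP m.+1)`_0 = 0 by rewrite coef_poly AH_log0.
have -> : E^`() - (logP m.+1)^`() * E = (Q^`() - (logP m.+1)^`() * Q)
    + ((E - Q)^`() - (logP m.+1)^`() * (E - Q)).
  by rewrite derivB; ring.
apply: dvdp_add; first exact: (exp_trunc_ode (@natr_neq0)).
apply/dvdXnP => i im; rewrite coefB coef_deriv coefM coefB EQ // subrr mul0rn.
rewrite big1 ?subrr // => j _; rewrite coefB EQ ?subrr ?mulr0 //.
by have := ltn_ord j; lia.
Qed.

Lemma expXp_coef_local l : (0 < l)%N ->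
  exists2 z, z \in p_local & p%:R ^+ l / l`!%:R = p%:R * z.
Proof.
move=> l0; have := logn_fact_lt p_prime l0.
have [d pd lE] := pfactor_coprime p_prime (fact_gt0 l) => vl.
exists (p%:R ^+ (l - (logn p l`!).+1) * d%:R^-1).
  by rewrite rpredM ?p_local_natV // rpredX // rpred_nat.
rewrite {1}lE natrM natrX mulrA -exprS -[X in p%:R ^+ X / _](subnK vl).
rewrite addnS -addSn exprD.
rewrite invfM [d%:R^-1 * _]mulrC mulrA mulfK //.
by rewrite expf_neq0 ?natr_p_neq0.
Qed.

Let Epoly m := \poly_(i < m) e i.
Let Rpoly m : {poly C} := \poly_(i < m) (p%:R ^+ i / i`!%:R).

(* exp(L(x)) ^ p = exp(L(x ^ p)) * exp(p x), since p L(x) = L(x ^ p) + p x. *)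
Lemma dwork_identity m :
  'X^(m.+1) %| Epoly m.+1 ^+ p - (Epoly m.+1 \Po 'X^p) * Rpoly m.+1.
Proof.
set E := Epoly _; set R := Rpoly _; set D := (logP m.+1)^`().
have [p_gt0 p0] := (prime_gt0 p_prime, natr_neq0).
have e0 : e 0%N = 1.
  by rewrite /e /Theta /fps_exp big_ord_recl big_ord0 /= addr0 divr1.
have R0 : R`_0 = 1 by rewrite coef_poly /= expr0 divr1.
have E0 : E`_0 = 1 by rewrite coef_poly /= e0.
have R_ode : 'X^m %| R^`() - p%:R * R.
  apply/dvdXnP => i im; rewrite coefB coef_deriv -polyC_natr coefCM !coef_poly.
  rewrite ltnS im ltnS ltnW // -[X in X - _]mulr_natr factS natrM exprS.
  move: (natr_neq0 (ltn0Sn i)) (natr_neq0 (fact_gt0 i)).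
  by move: (i.+1%:R) (i`!%:R) => x y x0 y0; field; rewrite y0.
(* Both terms solve $y'=pL'y$ modulo $X^m$ with constant term 1, so uniqueness applies to their
   difference. *)
apply: (@ode_unique _ natr_neq0 _ (p%:R * D)).
  rewrite coefB -horner_coef0 horner_exp horner_coef0 E0 expr1n.
  by rewrite coef0M coef_comp_poly_Xn // dvdn0 div0n E0 R0 mulr1 subrr.
have DX := deriv_log_frobenius m; have E_ode := AH_coef_ode m.
rewrite -/D in DX E_ode; rewrite -/E in E_ode.
have EX_ode : 'X^m %| (E^`() - D * E) \Po 'X^p.
  apply: dvdp_trans (dvdp_comp_poly 'X^p E_ode).
  by rewrite comp_Xn_poly -exprM dvdp_exp2l // leq_pmull.
have EpE : E ^+ p = E ^+ p.-1 * E by rewrite -exprSr prednK.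
rewrite derivB derivM deriv_comp derivXn deriv_exp.
rewrite -[(_ * _) *+ p]mulr_natl -['X^_ *+ p]mulr_natl.
rewrite comp_polyB comp_polyM in EX_ode.
(* One summand for each relation used: the equations of $E$, $R$ and $E(x^p)$, then
   $L'=1+x^{p-1}L'(x^p)$. *)
rewrite (_ : _ - _ = p%:R * E ^+ p.-1 * (E^`() - D * E)
  - (E \Po 'X^p) * (R^`() - p%:R * R)
  - p%:R * 'X^(p.-1) * R * ((E^`() \Po 'X^p) - (D \Po 'X^p) * (E \Po 'X^p))
  + p%:R * (E \Po 'X^p) * R * (D - 1 - (D \Po 'X^p) * 'X^(p.-1))).
  by apply: dvdp_add; [apply: dvdp_sub; [apply: dvdp_sub|]|]; exact: dvdp_mull.
by rewrite EpE; ring.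
Qed.

(** Strong induction. In degree [m], [dwork_identity] equates [p * e m] with terms that are [p]
    times p-local numbers: $A(x^p)-A^p$ by [p_local_frobenius], and the $p^l/l!$ by
    [expXp_coef_local]. *)
Lemma AH_coef_local m : e m \in p_local.
Proof.
have p_gt0 := prime_gt0 p_prime; have p_gt1 := prime_gt1 p_prime.
elim/ltn_ind: m => m IH; have [->|m_gt0] := posnP m.
  by rewrite /e /Theta /fps_exp big_ord_recl big_ord0 /= addr0 divr1 rpred1.
have /dvdXnP/(_ m (ltnSn m))/eqP := dwork_identity m.
set A := \poly_(i < m) e i.
have EA : Epoly m.+1 = A + e m *: 'X^m.
  by rewrite /Epoly /A !poly_def big_ord_recr.
have A0 : A`_0 = 1.
  rewrite coef_poly m_gt0 /e /Theta /fps_exp big_ord_recl big_ord0 /=.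
  by rewrite addr0 divr1.
have [B BP AB] := p_local_frobenius IH; rewrite -/A in AB.
(* Modulo $X^{m+1}$ only the linear term in [e m] survives, with factor [k] because [A] has constant
   term 1. *)
have pow k :
    'X^(m.+1) %| (A + e m *: 'X^m) ^+ k - A ^+ k - (k%:R * e m) *: 'X^m.
  have XM (P : {poly C}) : P`_0 = 0 -> 'X^(m.+1) %| 'X^m * P.
    move=> P0; rewrite exprSr; apply: dvdp_mul => //.
    by rewrite -['X]expr1; apply/dvdXnP => -[].
  elim: k => [|k IHk]; first by rewrite !expr0 subrr mul0r scale0r subrr.
  set c := e m in IHk *; rewrite -!mul_polyC polyCM polyC_natr in IHk *.
  rewrite (_ : _ - _ = (A + c%:P * 'X^m) *
      ((A + c%:P * 'X^m) ^+ k - A ^+ k - k%:R * c%:P * 'X^m)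
    + c%:P * ('X^m * (A ^+ k - 1))
    + k%:R * c%:P * ('X^m * (A + c%:P * 'X^m - 1))); last first.
    by rewrite !exprS -natr1; ring.
  apply: dvdp_add; [apply: dvdp_add|]; apply: dvdp_mull => //; apply: XM.
    rewrite coefB coef1 -horner_coef0 horner_exp horner_coef0 A0.
    by rewrite expr1n subrr.
  rewrite coefB coef1 coefD A0 coefCM coefXn eq_sym (gtn_eqF m_gt0).
  by rewrite mulr0 addr0 subrr.
have /dvdXnP/(_ m (ltnSn m))/eqP := pow p.
rewrite -EA !coefB coefZ coefXn eqxx mulr1 subr_eq0 subr_eq => /eqP ->.
(* Up to degree [m], composition with ['X^p] involves only indices at most $m/p<m$, so [e m] does
   not occur. *)
have EXj j : (j <= m)%N -> (Epoly m.+1 \Po 'X^p)`_j = (A \Po 'X^p)`_j.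
  move=> jm; rewrite !coef_comp_poly_Xn //; case: ifP => // _.
  rewrite EA coefD coefZ coefXn (_ : (j %/ p == m)%N = false) ?mulr0 ?addr0 //.
  by apply/negbTE; rewrite neq_ltn (leq_ltn_trans (leq_div2r _ jm)) // ltn_Pdiv.
have AXP : (A \Po 'X^p) \is a polyOver p_local.
  apply: polyOver_comp; last exact: polyOverXn.
  by apply/polyOver_poly => i; exact: IH.
rewrite coefM big_ord_recr /= subnn EXj // coef_poly /= expr0 divr1 mulr1.
rewrite AB coefD -polyC_natr coefCM subr_eq0.
(* The summand of index [m] gave the coefficient of $A(x^p)$, which cancels against that in $A^p$;
   the others carry $p^{m-i}/(m-i)!$ with $m-i>0$. *)
suff [z zP ->] : exists2 z, z \in p_local &
    \sum_(i < m) (Epoly m.+1 \Po 'X^p)`_i * (Rpoly m.+1)`_(m - i) = p%:R * z.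
  move=> /eqP E; rewrite (_ : e m = z - B`_m) ?rpredB // ?(polyOverP BP) //.
  apply: (mulfI natr_p_neq0); rewrite mulrBr.
  apply: (addrI ((A \Po 'X^p)`_m + p%:R * B`_m)).
  by rewrite [LHS]addrC; move: E => /= ->; ring.
apply: (big_ind (fun x => exists2 z, z \in p_local & x = p%:R * z)).
- by exists 0; rewrite ?rpred0 ?mulr0.
- move=> _ _ [x xP ->] [y yP ->]; exists (x + y); rewrite ?rpredD //.
  by rewrite mulrDr.
move=> i _; have im := ltn_ord i.
have [|z zP zE] := @expXp_coef_local (m - i)%N; first by lia.
exists ((A \Po 'X^p)`_i * z); first by rewrite rpredM // (polyOverP AXP).
by rewrite EXj ?(ltnW im) // coef_poly ltnS leq_subr zE mulrCA.
Qed.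

(** * The substitution of [gamma * x] for [x] *)

Lemma fps_pow_scale (c : C) (f h : nat -> C) j m :
  (forall i, f i = c ^+ i * h i) -> fps_pow f j m = c ^+ m * fps_pow h j m.
Proof.
move=> fh; elim: j m => [|j IH] m.
  by rewrite /= /fps_one; case: m => [|m]; rewrite ?expr0 ?mul1r ?mulr0.
have powS (k : nat -> C) :
  fps_pow k j.+1 m = \sum_(i < m.+1) k i * fps_pow k j (m - i)%N by [].
rewrite !powS mulr_sumr; apply: eq_bigr => i _.
have im : (i <= m)%N by rewrite -ltnS.
have -> : c ^+ m = c ^+ i * c ^+ (m - i) by rewrite -exprD subnKC.
by rewrite fh IH mulrACA.
Qed.

Lemma Theta_scale (gamma : C) m : Theta gamma m = gamma ^+ m * e m.
Proof.
rewrite /e /Theta /fps_exp mulr_sumr; apply: eq_bigr => j _.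
rewrite mulrA; congr (_ / _); apply: fps_pow_scale => i.
rewrite !AH_logE; case: ifP => _; last by rewrite mulr0.
by rewrite expr1n mul1r.
Qed.

Lemma is_ratr_sum (I : Type) (r : seq I) (P : pred I) (f : I -> C) :
  (forall i, P i -> is_ratr (f i)) -> is_ratr (\sum_(i <- r | P i) f i).
Proof.
move=> fP; elim/big_ind: _ => //; last exact: is_ratrD.
by apply: is_ratr_local; exact: rpred0.
Qed.

(** * The power [gamma ^+ p.-1] lies in Q_p *)

Section ArtinHasseRoot.
Variable gamma : C.
Hypothesis gamma_root : AH_root gamma.
Hypothesis ord_gamma : ordp gamma = ((p.-1)%:R^-1)%:E.
Let u := gamma ^+ p.-1.
(** The exponent is $(p^k-1)/(p-1)$, so that [gamma * S K u] is a partial sum of the series with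
    root [gamma]. *)
Let S K (x : C) := \sum_(k < K) x ^+ (\sum_(i < k) p ^ i) / (p ^ k)%:R.

Lemma p_gt2 : (2 < p)%N.
Proof. exact: odd_prime_gt2. Qed.

Lemma pred_p_neq0 : p.-1%:R != 0 :> rat.
Proof. by rewrite pnatr_eq0; have := p_gt2; lia. Qed.

Lemma ord_u : ordp u = 1%E.
Proof. by rewrite (ordpX _ ord_gamma) mulfV ?pred_p_neq0. Qed.

Lemma gamma_mul_S K :
  gamma * S K u = \sum_(k < K) gamma ^+ (p ^ k) / (p ^ k)%:R.
Proof.
rewrite mulr_sumr; apply: eq_bigr => k _.
rewrite mulrA -exprM -exprS -predn_exp prednK //.
by rewrite expn_gt0 prime_gt0.
Qed.

(** The exponent of [x] exceeds that of [p] in the denominator, [k.+2], by at least 2, which yields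
    the contraction; the base case is [p >= 3]. *)
Lemma geometric_ge k : (k.+4 <= \sum_(i < k.+2) p ^ i)%N.
Proof.
elim: k => [|k IH].
  by rewrite !big_ord_recr big_ord0 /=; have := p_gt2; lia.
rewrite big_ord_recr /= -[k.+1.+4]addn1.
by apply: leq_add => //; rewrite expn_gt0 prime_gt0.
Qed.

Let T K (x : C) :=
  \sum_(k < K) x ^+ (\sum_(i < k.+2) p ^ i) / (p ^ k.+2)%:R.

(** The first two terms of [S] are 1 and [x / p], so subtracting [p * S] cancels [x] and leaves the
    tail [T]. *)
Lemma sub_pS K x : x - p%:R * S K.+2 x = - p%:R * (1 + T K x).
Proof.
rewrite /S !big_ord_recl /= !big_ord0 /= addn0 expn0 expn1.
rewrite expr0 expr1 divr1.
have := natr_p_neq0; set y : C := p%:R => y0.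
have -> : \sum_(i < K) x ^+ (\sum_(i0 < bump 0 (bump 0 i)) p ^ i0) /
  (p ^ bump 0 (bump 0 i))%:R = T K x by [].
by field.
Qed.

Lemma ord_ge_subX M x y m : ord_ge 1 x -> ord_ge 1 y -> ord_ge M (x - y) ->
  ord_ge (M + m%:R) (x ^+ m.+1 - y ^+ m.+1).
Proof.
move=> x1 y1 xy; rewrite subrXX; apply: ord_geM => //.
apply: ord_ge_sum => i _; have im : (i <= m)%N by rewrite -ltnS.
rewrite -[X in X%:R](subnK im) natrD.
by apply: ord_geM; rewrite -[_%:R]mulr1; apply: ord_geX.
Qed.

Lemma ord_ge_pV k : ord_ge (- k%:R) ((p ^ k)%:R^-1 : C).
Proof.
by rewrite /ord_ge natrX (ordpV (ordpX k (ordp_p C))) mulr1.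
Qed.

(* u = gamma ^ (p - 1) is the fixed point of the contraction
   x |-> - p (1 + \sum_(k >= 2) x ^ (1 + p + ... + p ^ (k - 1)) / p ^ k). *)
Lemma root_approx N : exists r : C,
  [/\ is_ratr r, ord_ge 1 r & ord_ge N.+1%:R (u - r)].
Proof.
elim: N => [|N [r [rr r1 ur]]].
  exists 0; split; [exact: is_ratr_local (rpred0 _) | exact: ord_ge0|].
  by rewrite subr0 /ord_ge ord_u.
have [K0 /(_ K0.+2) HK] := gamma_root N.+2%:R.
have {}HK : ord_ge N.+2%:R (gamma * S K0.+2 u).
  by rewrite gamma_mul_S -[X in ord_ge _ X]subr0; apply: HK; lia.
have u1 : ord_ge 1 u by rewrite /ord_ge ord_u.
have g0 : gamma != 0 by apply/eqP => g0; move: ord_gamma; rewrite g0 ordp0.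
(* The next approximation is $-p(1+T(r))$. Its error has two parts: $T(r)-T(u)$, and the partial sum
   at [gamma], which is small but not zero. *)
have ur' : ord_ge N.+2%:R (u - (r - p%:R * S K0.+2 r)).
  have -> : u - (r - p%:R * S K0.+2 r) =
      p%:R * (T K0 r - T K0 u) + p%:R * (gamma^-1 * (gamma * S K0.+2 u)).
    rewrite mulKf // sub_pS; have := sub_pS K0 u.
    move: (S K0.+2 u) (T K0 u) => s t /eqP; rewrite subr_eq => /eqP ->.
    by ring.
  have p1 : ord_ge 1 (p%:R : C) by rewrite /ord_ge ordp_p.
  apply: ord_geD.
    apply: (@ord_ge_le (1 + N.+1%:R)); first by rewrite -[N.+2%:R]natr1 addrC.
    apply: ord_geM => //; rewrite -sumrB; apply: ord_ge_sum => k _.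
    rewrite -mulrBl -opprB mulNr ord_geN.
    have := geometric_ge k; case: (\sum_(i < _) _)%N => // m km.
    (* The exponent is [m.+1], so [m] exceeds [k.+2] and dividing by $p^{k+2}$ loses nothing; the
       factor [p] supplies the gain of 1. *)
    apply: (@ord_ge_le (N.+1%:R + m%:R - k.+2%:R)).
      by rewrite -addrA lerDl subr_ge0 ler_nat; lia.
    by apply: ord_geM; [exact: ord_ge_subX | exact: ord_ge_pV].
  apply: (@ord_ge_le (1 + (- 1 + N.+2%:R))); first by rewrite addNKr.
  apply: ord_geM => //; apply: ord_geM => //.
  (* Dividing by [gamma] costs $1/(p-1)\le 1$, which the factor [p] makes up for. *)
  apply: (@ord_ge_le (- (p.-1%:R)^-1)); last first.
    by rewrite /ord_ge (ordpV ord_gamma).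
  rewrite lerN2 invf_le1 ?ler1n ?ltr0n; have := p_gt2; lia.
exists (r - p%:R * S K0.+2 r); split=> //.
  apply: is_ratrD => //; rewrite -mulNr; apply: is_ratrM.
    by apply: is_ratr_local; rewrite rpredN rpred_nat.
  apply: is_ratr_sum => k _; apply: is_ratrM; first exact: is_ratrX.
  by apply: is_ratr_natV; rewrite expn_gt0 prime_gt0.
rewrite -[X in ord_ge _ X](subKr u); apply: ord_geB => //.
by apply: ord_ge_le ur'; rewrite ler1n.
Qed.

Lemma Qp_u : Qp u.
Proof.
apply/QpP => M; have [r [rr _ ur]] := root_approx `|Num.ceil M|%N.
exists r => //; apply: ord_ge_le ur.
apply: le_trans (ceil_ge M) _.
move: (Num.ceil M) => z; rewrite -[X in _ <= X]/(_.+1%:Z%:~R) ler_int; lia.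
Qed.

(** * Convergence of triple sums over growing cubes *)

Lemma ord_ge_sum_diff M N m (G G0 : nat -> C) : (N <= m)%N ->
  (forall i, (i < N)%N -> ord_ge M (G i - G0 i)) ->
  (forall i, (N <= i)%N -> ord_ge M (G i)) ->
  ord_ge M (\sum_(i < m) G i - \sum_(i < N) G0 i).
Proof.
move=> Nm GG0 GM; rewrite (big_ord_widen m G0 Nm) [X in _ - X]big_mkcond -sumrB.
apply: ord_ge_sum => i _; case: ltnP => [/GG0 //|/GM].
by rewrite subr0.
Qed.

(** A triple outside the cube of side [N] has [N <= i + j + k], so enlarging the cube adds only
    small terms. *)
Lemma cube_sum_cauchy (F : nat -> nat -> nat -> C) :
  (forall M, exists N, forall i j k,
    (N <= i + j + k)%N -> ord_ge M (F i j k)) ->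
  cauchy_ord (@ordp p C)
    (fun N => \sum_(i < N) \sum_(j < N) \sum_(k < N) F i j k).
Proof.
move=> Fsmall M; have [N NF] := Fsmall M.
have close m : (N <= m)%N -> ord_ge M
    (\sum_(i < m) \sum_(j < m) \sum_(k < m) F i j k
     - \sum_(i < N) \sum_(j < N) \sum_(k < N) F i j k).
  move=> Nm.
  apply: (ord_ge_sum_diff (G := fun i => \sum_(j < m) \sum_(k < m) F i j k)
    (G0 := fun i => \sum_(j < N) \sum_(k < N) F i j k)) => // i iN; last first.
    by do 2!apply: ord_ge_sum => ? _; apply: NF; lia.
  apply: (ord_ge_sum_diff (G := fun j => \sum_(k < m) F i j k)
    (G0 := fun j => \sum_(k < N) F i j k)) => // j jN; last first.
    by apply: ord_ge_sum => ? _; apply: NF; lia.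
  apply: (ord_ge_sum_diff (G := F i j) (G0 := F i j)) => // k kN.
    by rewrite subrr; exact: ord_ge0.
  by apply: NF; lia.
exists N => m k Nm Nk.
by have := ord_geB (close m Nm) (close k Nk); rewrite opprB addrA subrK.
Qed.

(** * Decomposition of B(a, b) over Q_p *)

Section Coefficients.
Variables (n : nat) (tbar : C) (Q : nat) (a b : int).
Hypothesis Q_gt0 : (0 < Q)%N.
Hypothesis tbarQ : tbar ^+ Q = 1.

Let cond i j k := ((n * i)%N%:Z - k%:Z == a) && (j%:Z - k%:Z == b).

(** The contribution of [(i, j, k)] divided by [tbar ^+ r * gamma ^+ s], kept only in the residue
    classes [r] and [s]; it involves only p-local numbers and [u], hence lies in Q_p. *)
Let F r s i j k : C :=
  if [&& cond i j k, k %% Q == r & (i + j + k) %% p.-1 == s]%N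
  then e i * e j * e k * u ^+ ((i + j + k) %/ p.-1) else 0.

Let Fsum r s N := \sum_(i < N) \sum_(j < N) \sum_(k < N) F r s i j k.

Lemma pred_p_gt0 : (0 < p.-1)%N.
Proof. by have := p_gt2; lia. Qed.

Lemma Bpartial_split N : Bpartial n gamma tbar a b N =
  \sum_(r < Q) \sum_(s < p.-1) tbar ^+ r * gamma ^+ s * Fsum r s N.
Proof.
rewrite pair_big /=.
set c := fun w : 'I_Q * 'I_p.-1 => tbar ^+ w.1 * gamma ^+ w.2.
have exchange (G : 'I_Q * 'I_p.-1 -> 'I_N -> C) :
    \sum_w c w * \sum_(i < N) G w i = \sum_(i < N) \sum_w c w * G w i.
  by rewrite exchange_big; apply: eq_bigr => w _; rewrite mulr_sumr.
rewrite exchange; apply: eq_bigr => i _.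
rewrite exchange; apply: eq_bigr => j _.
rewrite exchange big_mkcond; apply: eq_bigr => k _.
pose w0 := (Ordinal (ltn_pmod k Q_gt0),
            Ordinal (ltn_pmod (i + j + k) pred_p_gt0)).
rewrite (bigD1 w0) //= big1 ?addr0 => [|w ww0]; last first.
  rewrite /F; case: and3P => [[_ /eqP k1 /eqP k2]|]; last by rewrite mulr0.
  by case/eqP: ww0; case: w k1 k2 => r s /= k1 k2; congr (_, _); apply: val_inj.
rewrite /F /c /= !eqxx !andbT /cond; case: ifP => _; last by rewrite mulr0.
rewrite !Theta_scale expr_mod //.
have -> : gamma ^+ i * e i * (gamma ^+ j * e j) *
    (gamma ^+ k * e k * tbar ^+ k) =
    gamma ^+ (i + j + k) * (e i * e j * e k) * tbar ^+ k.
  by rewrite !exprD; ring.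
have -> : gamma ^+ (i + j + k) =
    u ^+ ((i + j + k) %/ p.-1) * gamma ^+ ((i + j + k) %% p.-1).
  by rewrite -exprM -exprD mulnC -divn_eq.
by ring.
Qed.

Lemma Fterm_ord r s i j k : ord_ge ((i + j + k) %/ p.-1)%:R (F r s i j k).
Proof.
rewrite /F; case: ifP => _; last exact: ord_ge0.
rewrite -[X in ord_ge X]add0r; apply: ord_geM.
  by apply: p_local_ord; rewrite !rpredM ?AH_coef_local.
by rewrite -[_%:R]mulr1; apply: ord_geX; rewrite /ord_ge ord_u.
Qed.

Lemma Fsum_cvg r s : exists l, cvg_ord (@ordp p C) (Fsum r s) l.
Proof.
apply: Cp_complete; apply: cube_sum_cauchy => M.
exists (`|Num.ceil M| * p.-1)%N => i j k ijk.
apply: ord_ge_le (Fterm_ord r s i j k).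
apply: le_trans (ceil_ge M) _.
rewrite -leq_divRL ?pred_p_gt0 // in ijk; move: ijk.
move: (Num.ceil M) (_ %/ _)%N => z m.
by rewrite [X in _ <= X]pmulrn ler_int; lia.
Qed.

Lemma Fsum_Qp r s N : Qp (Fsum r s N).
Proof.
do 3![apply: (big_ind (@Qp p C)) => [||? _]; [exact: Qp0 | exact: QpD |]].
rewrite /F; case: ifP => _; last exact: Qp0.
apply: QpM; last by apply: QpX; exact: Qp_u.
by apply: Qp_ratr; apply: is_ratr_local; rewrite !rpredM ?AH_coef_local.
Qed.

(** The factor [gamma ^+ s] restores what the floor in the exponent of [u] drops: each nonzero term
    becomes a p-local multiple of [gamma ^+ (i + j + k)]. *)
Lemma Fsum_ord M r s N :
  (forall i j k, cond i j k -> M * (p.-1)%:R <= (i + j + k)%:R) ->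
  ord_ge M (gamma ^+ s * Fsum r s N).
Proof.
move=> HM; rewrite mulr_sumr; apply: ord_ge_sum => i _.
rewrite mulr_sumr; apply: ord_ge_sum => j _.
rewrite mulr_sumr; apply: ord_ge_sum => k _.
rewrite /F; case: and3P => [[/HM ijk _ /eqP <-]|_]; last first.
  by rewrite mulr0; exact: ord_ge0.
rewrite mulrCA -[M]add0r; apply: ord_geM.
  by apply: p_local_ord; rewrite !rpredM ?AH_coef_local.
rewrite -exprM -exprD mulnC addnC -divn_eq.
rewrite /ord_ge (ordpX _ ord_gamma) lee_fin ler_pdivlMr //.
by rewrite ltr0n pred_p_gt0.
Qed.

(** * Action on B(a, b) of a ring morphism fixing Q_p and gamma *)

Variables (L : set C) (tau : C -> C).
Hypothesis L_add : forall x y, L x -> L y -> L (x + y).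
Hypothesis L_mul : forall x y, L x -> L y -> L (x * y).
Hypothesis L_Qp : forall x, Qp x -> L x.
Hypothesis L_gamma : L gamma.
Hypothesis L_tbar : L tbar.
Hypothesis tauD : forall x y, L x -> L y -> tau (x + y) = tau x + tau y.
Hypothesis tauM : forall x y, L x -> L y -> tau (x * y) = tau x * tau y.
Hypothesis tau_Qp : forall x, Qp x -> tau x = x.
Hypothesis tau_gamma : tau gamma = gamma.

Lemma L_exp x m : L x -> L (x ^+ m).
Proof.
move=> Lx; elim: m => [|m IH]; last by rewrite exprS; apply: L_mul.
by apply: L_Qp; exact: Qp1.
Qed.

Lemma tau_exp x m : L x -> tau (x ^+ m) = tau x ^+ m.
Proof.
move=> Lx; elim: m => [|m IH]; last by rewrite !exprS tauM ?IH //; apply: L_exp.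
by rewrite !expr0 tau_Qp //; exact: Qp1.
Qed.

Lemma tau_sum (I : Type) (r : seq I) (f : I -> C) : (forall i, L (f i)) ->
  L (\sum_(i <- r) f i) /\ tau (\sum_(i <- r) f i) = \sum_(i <- r) tau (f i).
Proof.
move=> Lf; elim: r => [|i r [Lr IH]].
  by rewrite !big_nil tau_Qp; [split=> //; apply: L_Qp|]; exact: Qp0.
by rewrite !big_cons tauD // IH; split=> //; apply: L_add.
Qed.

Lemma tau_tbar_ord m : ord_ge 0 (tau tbar ^+ m).
Proof.
have tQ : tau tbar ^+ Q = 1.
  rewrite -tau_exp // tbarQ tau_Qp //; exact: Qp1.
have t0 : tau tbar != 0.
  apply/eqP => t0; move: tQ; rewrite t0 expr0n eqn0Ngt Q_gt0.
  by move=> /esym/eqP; rewrite oner_eq0.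
have [v tv] := ordp_fin t0.
have := ordpX Q tv; rewrite tQ ordp1 => -[] /esym/eqP.
rewrite mulf_eq0 pnatr_eq0 eqn0Ngt Q_gt0 /= => /eqP v0.
by rewrite /ord_ge (ordpX m tv) v0 mulr0.
Qed.

(** Without continuity, [tau] cannot be moved inside the limit defining [B]. It is applied instead
    to a finite sum whose limits [l w] lie in Q_p, where [tau] is the identity. *)
Lemma tau_B_ord M :
  (forall i j k, cond i j k -> M * (p.-1)%:R <= (i + j + k)%:R) ->
  ord_ge M (tau (B n gamma tbar a b)).
Proof.
move=> HM.
have [l Hl] := choice (fun w : 'I_Q * 'I_p.-1 => Fsum_cvg w.1 w.2).
have Ql w : Qp (l w) by apply: Qp_cvg (Hl w) => m; exact: Fsum_Qp.
have -> : B n gamma tbar a b =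
    \sum_(w : 'I_Q * 'I_p.-1) tbar ^+ w.1 * (gamma ^+ w.2 * l w).
  apply: lim_ordE; rewrite (_ : Bpartial _ _ _ _ _ = fun N =>
    \sum_(w : 'I_Q * 'I_p.-1) tbar ^+ w.1 * (gamma ^+ w.2 * Fsum w.1 w.2 N)).
    by apply: cvg_ord_sum => w; do 2!apply: cvg_ordZ; exact: Hl.
  apply/funext => N; rewrite Bpartial_split pair_big /=.
  by apply: eq_bigr => w _; rewrite mulrA.
have LL (w : 'I_Q * 'I_p.-1) : L (gamma ^+ w.2 * l w).
  by apply: L_mul; [exact: L_exp | exact: L_Qp].
have [|_ ->] := @tau_sum _ (index_enum ('I_Q * 'I_p.-1)%type)
    (fun w : 'I_Q * 'I_p.-1 => tbar ^+ w.1 * (gamma ^+ w.2 * l w)).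
  by move=> w; apply: L_mul => //; exact: L_exp.
apply: ord_ge_sum => w _; rewrite tauM //; last exact: L_exp.
rewrite tau_exp // -[M]add0r; apply: ord_geM; first exact: tau_tbar_ord.
rewrite tauM ?tau_exp ?tau_gamma ?tau_Qp //; [|exact: L_exp|exact: L_Qp].
apply: (ord_ge_cvg (u := fun N => gamma ^+ w.2 * Fsum w.1 w.2 N)).
  by move=> N; exact: Fsum_ord.
by apply: cvg_ordZ; exact: Hl.
Qed.

End Coefficients.
End ArtinHasseRoot.
End Valuation.

(** * The map [g] and the weight of lattice points *)

Lemma ceil_termE n varpi i : (0 < n)%N ->
  ceil_term n varpi i = (varpi * i %% n)%N%:Z.
Proof.
move=> n_gt0; rewrite /ceil_term; set m := (varpi * i)%N.
have n0 : 0 < n%:R :> rat by rewrite ltr0n.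
have mE := divn_eq m n; have mn := ltn_pmod m n_gt0.
(* The ceiling of $-m/n$ is minus the quotient, which leaves the remainder. *)
rewrite (@ceil_def _ _ (- (m %/ n)%N%:Z)).
  by move: (m %/ n)%N (m %% n)%N mE mn => s r -> _; rewrite PoszD PoszM; ring.
rewrite ltr_pdivlMr // ler_pdivrMr // intrB !mulrNz -!pmulrn mulrBl mulNr mul1r.
have -> : m%:R = (m %/ n)%:R * n%:R + (m %% n)%:R :> rat.
  by rewrite -natrM -natrD -mE.
move: mn; rewrite -(ltr_nat rat); have := ler0n rat (m %% n).
by move: (_ * _) (m %% n)%:R => x y; lra.
Qed.

Lemma gE n varpi i : (0 < n)%N -> (i <= 2 * n)%N ->
  [\/ i \in [:: 0; n; 2 * n]%N /\ g n varpi i = i%:Z,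
      (0 < i < n)%N /\ g n varpi i = (varpi * i %% n)%N%:Z
    | (n < i < 2 * n)%N /\ g n varpi i = n%:Z + (varpi * i %% n)%N%:Z].
Proof.
move=> n0 i2n; rewrite /g; case: ifP => [|/negbT]; first by constructor 1.
rewrite !inE !negb_or => /and3P[i0 i_n i_2n].
case: ltnP => i_lt_n; rewrite ceil_termE //; [constructor 2|constructor 3].
  by split=> //; lia.
by split=> //; lia.
Qed.

Lemma nomega_nonneg n (x y : int) : 0 <= x -> 0 <= y ->
  nomega n (x, y) = x + n%:Z * y.
Proof.
move=> x0 y0; rewrite /nomega /=.
have -> : Num.max 0 (Num.max (- x) (- y)) = 0 by lia.
by rewrite mulr0 addr0.
Qed.

Lemma nomega_eps n (i : nat) : nomega n (eps n i%:Z) = i%:Z.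
Proof.
rewrite /eps; case: lerP => in_; rewrite nomega_nonneg ?mulr0 ?addr0 //.
  by rewrite mulr1 subrK.
by rewrite subr_ge0 ltW.
Qed.

(** * The lattice inequality for contributing terms *)

Section Contributions.
Variables (n p varpi : nat) (c d : int) (i i1 j k : nat).
Hypothesis n_gt0 : (0 < n)%N.
Hypothesis p_gt0 : (0 < p)%N.
Hypothesis varpi_gt0 : (0 < varpi)%N.
Hypothesis varpi_inv : p * varpi = 1 %[mod n].
Hypothesis i_le : (i <= 2 * n)%N.
Hypothesis cd_le : nomega n (c, d) <= g n varpi i.
Hypothesis cd_neq : (c, d) <> eps n (g n varpi i).
Hypothesis contrib1 : (n * i1)%N%:Z - k%:Z = p%:Z * c - (eps n i%:Z).1.
Hypothesis contrib2 : j%:Z - k%:Z = p%:Z * d - (eps n i%:Z).2.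

(** For [k = 0], [p * c] is congruent to [i] modulo [n]; multiply by [varpi], the inverse of [p]. *)
Lemma congruence_nonneg : k = 0%N ->
  exists z : int, c = (varpi * i)%N%:Z + n%:Z * z.
Proof.
move=> k0; move: contrib1; rewrite k0 subr0 => E1.
have [l lE] : exists l, (p * varpi = l * n + 1)%N.
  move/eqP: varpi_inv; rewrite eqn_mod_dvd ?muln_gt0 ?p_gt0 // => /dvdnP[l lE].
  by exists l; rewrite -lE subnK ?muln_gt0 ?p_gt0.
have {}lE : p%:Z * varpi%:Z = l%:Z * n%:Z + 1 by rewrite -!PoszM lE PoszD.
have [w wE] : exists w : int, (eps n i%:Z).1 = i%:Z + n%:Z * w.
  rewrite /eps; case: ifP => _ /=; first by exists 0; rewrite mulr0 addr0.
  by exists (-1); rewrite mulrN1.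
exists (i1%:Z * varpi%:Z - l%:Z * c + varpi%:Z * w).
have pcE : p%:Z * c = n%:Z * i1%:Z + (i%:Z + n%:Z * w).
  by rewrite -wE -PoszM E1 subrK.
have cE : c = varpi%:Z * (p%:Z * c) - l%:Z * n%:Z * c.
  by rewrite mulrA [varpi%:Z * _]mulrC lE; ring.
by rewrite [LHS]cE pcE PoszM; ring.
Qed.

(** Let $M$ be the maximum and suppose $k\le pM$. If $c,d\ge 0$, then $k=0$, and the congruence with
    the weight bound leaves only the excluded point. Otherwise $c=-M$ or $d=-M$, and the signs of
    [i1] and [j] restrict [i] until $g(i)$ is below the weight. *)
Lemma contribution_gt : p%:Z * Num.max 0 (Num.max (- c) (- d)) < k%:Z.
Proof.
rewrite ltNge; apply/negP => kle.
have n1 : 0 < n%:Z by lia.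
have p1 : 0 < p%:Z by lia.
have E1 : p%:Z * c - (eps n i%:Z).1 + k%:Z = n%:Z * i1%:Z.
  by rewrite -contrib1 PoszM; lia.
have i10 : 0 <= n%:Z * i1%:Z by rewrite -PoszM.
have E2 : p%:Z * d - (eps n i%:Z).2 + k%:Z = j%:Z by rewrite -contrib2; lia.
have k0 : 0 <= k%:Z by [].
have j0 : 0 <= j%:Z by [].
have gr := gE varpi n_gt0 i_le.
have mod_lt := ltn_pmod (varpi * i) n_gt0.
have := cd_le; rewrite /nomega /=; set M := Num.max 0 _ in kle * => W.
have [/andP[c0 d0]|neg] := boolP ((0 <= c) && (0 <= d)).
  have M0 : M = 0 by rewrite /M; lia.
  rewrite M0 mulr0 addr0 in W; rewrite M0 mulr0 in kle.
  have k00 : k = 0%N by lia.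
  have [z cE] := congruence_nonneg k00.
  rewrite k00 addr0 in E1 E2.
  have {}cE : exists z' : int, c = (varpi * i %% n)%N%:Z + n%:Z * z'.
    exists (z + (varpi * i %/ n)%N%:Z); rewrite cE {1}(divn_eq (varpi * i) n).
    by rewrite PoszD PoszM; ring.
  case: cE => z' cE.
  have nd0 : 0 <= n%:Z * d by rewrite pmulr_rge0.
  case: gr => [[i_in gi]|[/andP[i0 i_n] gi]|[/andP[i_n i_2n] gi]].
  (* Here [n] divides [i], so [c] is a multiple of [n]. *)
  - have r0 : (varpi * i %% n = 0)%N.
      apply/eqP; apply: dvdn_mull; move: i_in; rewrite !inE.
      by case/or3P=> /eqP->; rewrite ?dvdn0 ?dvdn_mull.
    rewrite r0 add0r in cE; move: i_in; rewrite !inE.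
    case/or3P=> /eqP iE; have := cd_neq; rewrite gi iE => neq;
      rewrite gi iE in W; rewrite iE /eps in E1 E2 neq.
    + apply: neq; have d_le : d <= 0 by rewrite -(ler_pM2l n1); lia.
      by congr (_, _); lia.
    + rewrite lexx /= in E1 E2 neq.
      have c_gt0 : 0 < c by rewrite -(pmulr_rgt0 _ p1); lia.
      have z_gt0 : 0 < z' by rewrite -(pmulr_rgt0 _ n1) -cE.
      have : n%:Z * (z' + d) <= n%:Z * 1 by rewrite mulrDr -cE mulr1.
      rewrite ler_pM2l // => zd; apply: neq.
      have -> : d = 0 by lia.
      by rewrite cE (_ : z' = 1) ?mulr1 //; lia.
    + rewrite (_ : (_ <= _) = false) /= in E1 E2 neq; last by lia.
      have c_gt0 : 0 < c by rewrite -(pmulr_rgt0 _ p1); lia.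
      have d_gt0 : 0 < d by rewrite -(pmulr_rgt0 _ p1); lia.
      have z_gt0 : 0 < z' by rewrite -(pmulr_rgt0 _ n1) -cE.
      have : n%:Z * (z' + d) <= n%:Z * 2 by rewrite mulrDr -cE; lia.
      rewrite ler_pM2l // => zd; apply: neq.
      have -> : d = 1 by lia.
      by rewrite cE (_ : z' = 1) ?mulr1; [congr (_, _)|]; lia.
  (* Since [c >= 0] and the residue is below [n], [z'] is nonnegative; the weight bound gives
     [z' + d <= 0], so both vanish. *)
  - rewrite gi in W.
    have z_gt : -1 < z' by rewrite -(ltr_pM2l n1) mulrN1; lia.
    have : n%:Z * (z' + d) <= n%:Z * 0 by rewrite mulrDr mulr0; lia.
    rewrite ler_pM2l // => zd; apply: cd_neq.
    rewrite gi /eps lez_nat ltnW //.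
    by rewrite cE (_ : z' = 0) ?mulr0 ?addr0; [congr (_, _)|]; lia.
  rewrite gi in W; rewrite /eps lez_nat leqNgt i_n /= in E2.
  have d_gt0 : 0 < d by rewrite -(pmulr_rgt0 _ p1); lia.
  have z_gt : -1 < z' by rewrite -(ltr_pM2l n1) mulrN1; lia.
  have : n%:Z * (z' + d) <= n%:Z * 1 by rewrite mulrDr mulr1; lia.
  rewrite ler_pM2l // => zd; apply: cd_neq.
  (* Needed for [eps] to take its second branch at $g(i)=n+r$. A zero residue would make [n] divide
     [i], as [p * varpi] is 1 modulo [n]. *)
  have r_gt0 : (0 < varpi * i %% n)%N.
    rewrite lt0n; apply/negP => /dvdnP[l lE].
    have : (n %| i)%N.
      rewrite /dvdn -[i]mul1n -modnMml -varpi_inv modnMml -mulnA lE.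
      by rewrite mulnA modnMl.
    move=> /dvdnP[m mE]; move: i_n i_2n.
    by rewrite mE -{1}[n]mul1n !ltn_pmul2r //; clear; lia.
  rewrite gi /eps (_ : (_ <= _) = false); last by lia.
  by rewrite cE (_ : z' = 0) ?mulr0 ?addr0; [congr (_, _)|]; lia.
have M1 : 0 < M by rewrite /M; lia.
have [cM dM] : - M <= c /\ - M <= d by rewrite /M; lia.
have nM : 0 < n%:Z * M by rewrite mulr_gt0.
have ndM : - (n%:Z * M) <= n%:Z * d by rewrite -mulrN ler_pM2l.
have ME : (2 * n + 1)%N%:Z * M = 2 * (n%:Z * M) + M.
  by rewrite PoszD PoszM; ring.
(* If [c = - M], then [i1 >= 0] forces [i = 0] and $g(i)=0$, while $n\omega(c,d)\ge nM>0$. *)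
have [cE|c_neq] := eqVneq c (- M).
  rewrite cE mulrN in E1.
  have i0 : i = 0%N by move: E1; rewrite /eps; case: ifP => /= ?; lia.
  by rewrite i0 /g inE /= in W; lia.
(* Now [- M < c], and [j >= 0] forces [i <= n], so $g(i)\le n$ while $n\omega(c,d)\ge nM+1$. *)
have dE : d = - M by move: c_neq neg; rewrite /M; clear; lia.
rewrite dE mulrN in E2.
have i_n : (i <= n)%N by move: E2; rewrite /eps; case: ifP => /= ?; lia.
have nM' : n%:Z * 1 <= n%:Z * M by rewrite ler_pM2l.
have gn : g n varpi i <= n%:Z.
  by case: gr => [[_ ->]|[_ ->]|[/andP[? _] _]]; lia.
by rewrite dE mulrN ME in W; lia.
Qed.

(** Adding [n] times the second contribution equation to the first gives
    $n(i_1+j+k)+i=p(c+nd)+(2n+1)k$, and [contribution_gt] bounds [k]. *)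
Lemma contribution_bound :
  p%:Z * nomega n (c, d) + 1 <= (n * (i1 + j + k) + i)%N%:Z.
Proof.
have := contribution_gt; rewrite /nomega /=; set M := Num.max 0 _ => kM.
have : (2 * n + 1)%N%:Z * (p%:Z * M + 1) <= (2 * n + 1)%N%:Z * k%:Z.
  by rewrite ler_pM2l //; lia.
have -> : (n * (i1 + j + k) + i)%N%:Z =
    p%:Z * (c + n%:Z * d) + (2 * n + 1)%N%:Z * k%:Z.
  have iE : (eps n i%:Z).1 + n%:Z * (eps n i%:Z).2 = i%:Z.
    by rewrite /eps; case: ifP => _ /=; ring.
  rewrite !mulnDr !PoszD -iE.
  have /eqP := contrib1; rewrite subr_eq => /eqP ->.
  have /eqP := contrib2; rewrite subr_eq PoszM => /eqP ->.
  by rewrite !PoszM; ring.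
rewrite [p%:Z * (_ + _ * M)]mulrDr [p%:Z * (_ * M)]mulrCA mulrDr mulr1.
by move: (p%:Z * (c + _)) (p%:Z * M) => x y; lia.
Qed.

End Contributions.

(** * Sums and products in generated subfields *)

Section SubfieldGen.
Variables (p : nat) (C : padicC p) (S : set C).

Lemma sub_subfield_gen x : S x -> subfield_gen S x.
Proof. by move=> Sx K [_ SK]; exact: SK. Qed.

Lemma subfield_gen_closed : is_subfield (subfield_gen S).
Proof.
split.
- by apply: mem_set => K [[K1 _ _] _]; exact: set_mem.
- move=> x y /set_mem Sx /set_mem Sy; apply: mem_set => K KS.
  have [[_ KB _] _] := KS; apply: set_mem.
  by apply: KB; apply: mem_set; [exact: Sx | exact: Sy].
- move=> x y /set_mem Sx /set_mem Sy; apply: mem_set => K KS.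
  have [[_ _ Kdiv] _] := KS; apply: set_mem.
  by apply: Kdiv; apply: mem_set; [exact: Sx | exact: Sy].
Qed.

Lemma subfield_genD x y :
  subfield_gen S x -> subfield_gen S y -> subfield_gen S (x + y).
Proof.
have [K1 KB _] := subfield_gen_closed => /mem_set Sx /mem_set Sy.
apply: set_mem; rewrite -[y]opprK -[- y]add0r; apply: (KB) => //.
by apply: (KB) => //; rewrite -(subrr (1 : C)); exact: KB.
Qed.

Lemma subfield_genM x y :
  subfield_gen S x -> subfield_gen S y -> subfield_gen S (x * y).
Proof.
have [K1 _ Kdiv] := subfield_gen_closed => /mem_set Sx /mem_set Sy.
apply: set_mem; rewrite -[y]invrK -[y^-1]mul1r; apply: (Kdiv) => //.
exact: Kdiv.
Qed.

End SubfieldGen.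

(** * The strict bound on the order of the matrix coefficient *)

Theorem theorem2p9
  (n p a : nat) (n_gt1 : (1 < n)%N)
  (p_prime : prime p) (p_odd : odd p) (p_ndvd_n : ~~ (p %| n)%N)
  (a_gt0 : (0 < a)%N)
  (C : padicC p)
  (F : finFieldType) (cardF : #|F| = (p ^ a)%N)
  (red : C -> F) (red_spec : is_reduction (p ^ a) red)
  (t : F) (t_neq0 : t != 0)
  (tbar : C) (tbar_spec : is_teichmuller (p ^ a) red t tbar)
  (gamma : C) (gamma_root : AH_root gamma)
  (ord_gamma : ordp gamma = ((p.-1)%:R^-1)%:E)
  (gammat : C) (gammatE : gammat ^+ n = gamma)
  (zeta : C) (zeta_prim : p.-primitive_root zeta)
  (sigma sigmaV : C -> C)
  (sigma_spec : is_frobenius (p ^ a) zeta gammat sigma sigmaV)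
  (varpi : nat) (varpi_gt0 : (0 < varpi)%N) (varpi_lt : (varpi < n)%N)
  (varpi_inv : p * varpi = 1 %[mod n])
  (c d : int) (i : nat) (i_le : (i <= 2 * n)%N) :
  omega n (c, d) <= (g n varpi i)%:~R / n%:R ->
  (c, d) <> eps n (g n varpi i) ->
  ((omega n (c, d))%:E < ordp (A n sigmaV gamma gammat tbar (c, d) (eps n i%:Z)))%E.
Proof.
move=> omega_le cd_neq.
have n_gt0 : (0 < n)%N by apply: ltnW.
have n0 : 0 < n%:R :> rat by rewrite ltr0n.
have p1_gt0 : (0 < p.-1)%N by have := odd_prime_gt2 p_odd p_prime; lia.
have p10 : 0 < p.-1%:R :> rat by rewrite ltr0n.
have omegaE : omega n (c, d) = (nomega n (c, d))%:~R / n%:R.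
  by rewrite nomegaE // mulrC mulKf // gt_eqF.
have cd_le : nomega n (c, d) <= g n varpi i.
  by move: omega_le; rewrite omegaE ler_pM2r ?invr_gt0 // ler_int.
set L := Qq_ext (p ^ a) zeta gammat.
have Qp_Qq x : Qp x -> Qq (p ^ a) x by move=> Qx; apply: sub_subfield_gen; left.
have Qq_L x : Qq (p ^ a) x -> L x by move=> Qx; apply: sub_subfield_gen; left.
have L_gammat : L gammat by apply: sub_subfield_gen; right; right.
have L_mul x y : L x -> L y -> L (x * y) by exact: subfield_genM.
have L_add x y : L x -> L y -> L (x + y) by exact: subfield_genD.
have [tbarZ tE tbarq] := tbar_spec; have [tbarQq _] := set_mem tbarZ.
(* The reduction of 0 is 0, not [t]; dividing [tbar ^+ (p ^ a) = tbar] by [tbar] then gives a root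
   of unity. *)
have tbar0 : tbar != 0.
  apply: contra_neq t_neq0; rewrite -tE => ->; apply/(red_eq0 red_spec).
    apply: mem_set; split; last by rewrite ordp0 leey.
    by apply: Qp_Qq; exact: Qp0.
  by rewrite ordp0.
have q_gt1 : (1 < p ^ a)%N by rewrite -(exp1n a) ltn_exp2r // prime_gt1.
have tbarQ : tbar ^+ (p ^ a).-1 = 1.
  by apply: (mulfI tbar0); rewrite mulr1 -exprS prednK // ltnW.
have [_ /(_ _ (mem_set _))VL VK KV sD sM sQp _ _ sg] := sigma_spec.
have {}VL x : L x -> L (sigmaV x) by move=> Lx; apply: set_mem; exact: VL.
have VD x y : L x -> L y -> sigmaV (x + y) = sigmaV x + sigmaV y.
  move=> Lx Ly; rewrite -{1}(KV x) ?mem_set // -{1}(KV y) ?mem_set //.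
  by rewrite -sD ?mem_set ?VK ?mem_set //; [apply: L_add|..]; exact: VL.
have VM x y : L x -> L y -> sigmaV (x * y) = sigmaV x * sigmaV y.
  move=> Lx Ly; rewrite -{1}(KV x) ?mem_set // -{1}(KV y) ?mem_set //.
  by rewrite -sM ?mem_set ?VK ?mem_set //; [apply: L_mul|..]; exact: VL.
have V_Qp x : Qp x -> sigmaV x = x.
  move=> Qx; rewrite -{1}(sQp x) ?mem_set // VK // mem_set //.
  by apply: Qq_L; exact: Qp_Qq.
have V_gammat : sigmaV gammat = gammat by rewrite -{1}sg VK ?mem_set.
have L_Qp x : Qp x -> L x by move=> Qx; apply: Qq_L; exact: Qp_Qq.
have L_gamma : L gamma by rewrite -gammatE; exact: (L_exp p_prime L_mul L_Qp).
have V_gamma : sigmaV gamma = gamma.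
  by rewrite -gammatE (tau_exp p_prime L_mul L_Qp VM V_Qp) // V_gammat.
pose W := nomega n (c, d).
(* By [contribution_bound], a contributing triple has [n * (i1 + j + k)] at least $pW+1-i$, and each
   unit of [i1 + j + k] is worth $1/(p-1)$. *)
pose M : rat := (p%:Z * W + 1 - i%:Z)%:~R / (n%:R * p.-1%:R).
have BM : ord_ge M (sigmaV (B n gamma tbar (p%:Z * c - (eps n i%:Z).1)
    (p%:Z * d - (eps n i%:Z).2))).
  apply: (tau_B_ord p_prime p_odd gamma_root ord_gamma _ tbarQ L_add L_mul)
    => //.
  - by rewrite -ltnS prednK // ltnW.
  - exact: Qq_L.
  move=> i1 j k /andP[/eqP E1 /eqP E2]; rewrite /M invfM mulrA divfK ?gt_eqF //.
  rewrite ler_pdivrMr // -natrM [X in _ <= X]pmulrn ler_int.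
  rewrite mulnC lerBlDr -PoszD.
  exact: (contribution_bound n_gt0 (prime_gt0 p_prime) varpi_gt0 varpi_inv i_le
    cd_le cd_neq E1 E2).
have gt0 : gammat != 0.
  apply/eqP => g0; move: ord_gamma.
  by rewrite -gammatE g0 expr0n gtn_eqF // ordp0.
have [v vE] := ordp_fin gt0.
have vn : v = (n%:R * p.-1%:R)^-1.
  have := ordpX n vE; rewrite gammatE ord_gamma => -[] E.
  by rewrite invfM E mulKf // gt_eqF.
(* The power of [gammat] adds $(i-W)/(n(p-1))$ to [M]. The total is $W/n+1/(n(p-1))$, whose last
   summand gives strictness. *)
rewrite /A /= ordpM (ordp_exprz _ vE) nomega_eps -/W.
apply: lt_le_trans (leeD BM (le_refl _)); rewrite -EFinD lte_fin omegaE -/W.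
rewrite /M vn -mulrDl -intrD.
have -> : p%:Z * W + 1 - i%:Z + (i%:Z - W) = p.-1%:Z * W + 1.
  by rewrite -{1}(prednK (prime_gt0 p_prime)) -addn1 PoszD; ring.
have -> : (p.-1%:Z * W + 1)%:~R / (n%:R * p.-1%:R) =
    W%:~R / n%:R + (n%:R * p.-1%:R)^-1 :> rat.
  by rewrite intrD intrM -[p.-1%:Z%:~R]pmulrn; field; rewrite !gt_eqF.
by rewrite ltrDl invr_gt0 mulr_gt0.
Qed.
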